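(* Let $\Phi,\Psi\in\mathbb{R}^{n\times n}$ be symmetric matrices with eigenvalues $\phi_1\le\dots\le\phi_n$ and $\psi_1\le\dots\le\psi_n$ and corresponding orthonormal eigenvectors $w_1,\dots,w_n$ ($\Phi w_i=\phi_iw_i$) and $v_1,\dots,v_n$ ($\Psi v_i=\psi_iv_i$). Fix integers $j\ge0$, $r\ge1$ with $j+r\le n$, let $J=\{j+1,\dots,j+r\}$, $W_j=[w_{j+1},\dots,w_{j+r}]$ and $V_j=[v_{j+1},\dots,v_{j+r}]$. Assume the nonzero eigengap conditions $\phi_{j+1}-\phi_j>0$, $\phi_{j+r+1}-\phi_{j+r}>0$, $\psi_{j+1}-\psi_j>0$, $\psi_{j+r+1}-\psi_{j+r}>0$. Let $p$ be a real polynomial, $p(t)=c_lt^l+\dots+c_1t+c_0$, with $p(\Phi)=c_l\Phi^l+\dots+c_1\Phi+c_0I$. Define the two candidate parameter triplets $$a_1=\min_{i\in J}p(\phi_i),\quad b_1=\max_{i\in J}p(\phi_i),\quad \delta_1=\min(\psi_{j+r+1}-b_1,\ a_1-\psi_j),$$ $$a_2=\psi_{j+1},\quad b_2=\psi_{j+r},\quad \delta_2=\min\Big(\min_{i\in\mathcal{A}_1}p(\phi_i)-b_2,\ a_2-\max_{i\in\mathcal{A}_2}p(\phi_i)\Big),$$ where, for a triplet $(a,b,\delta)$, $\mathcal{A}_1=\{i\in\{1,\dots,n\}\setminus J: p(\phi_i)>b\}$ and $\mathcal{A}_2=\{i\in\{1,\dots,n\}\setminus J: p(\phi_i)<a\}$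 (in $\delta_2$ these are taken with $a=a_2,b=b_2$). Suppose that one of the following holds: (A) with $a=a_1,b=b_1$ one has $\mathcal{A}_1\cup\mathcal{A}_2=\{1,\dots,n\}\setminus J$, and $\delta_1>0$, $a_1-\psi_{j+1}<\delta_1$, $\psi_{j+r}-b_1<\delta_1$; in this case set $\delta=\delta_1$; (B) with $a=a_2,b=b_2$ one has $\mathcal{A}_1\cup\mathcal{A}_2=\{1,\dots,n\}\setminus J$, and $\delta_2>0$, $a_2-\min_{i\in J}p(\phi_i)<\delta_2$, $\max_{i\in J}p(\phi_i)-b_2<\delta_2$; in this case set $\delta=\delta_2$. Then for every unitarily invariant norm $\|\cdot\|$, $$\big\|W_jW_j^T(I-V_jV_j^T)\big\|\le\frac{\|p(\Phi)-\Psi\|}{\delta}.$$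
   Context: Convention: eigenvalues with out-of-range indices are interpreted as $\phi_0=\psi_0=-\infty$ and $\phi_{n+1}=\psi_{n+1}=+\infty$ (so conditions involving them are vacuous when $j=0$ or $j+r=n$), and a minimum over an empty index set is $+\infty$, a maximum over an empty index set is $-\infty$. A norm on $n\times n$ matrices is unitarily invariant if $\|UXV\|=\|X\|$ for all orthogonal $U,V$. $I$ is the $n\times n$ identity matrix. *)

(* Defs.v *)
From HB Require Import structures.
From mathcomp Require Import all_boot all_order all_algebra.
From mathcomp Require Import reals constructive_ereal.
Set Implicit Arguments. Unset Strict Implicit. Unset Printing Implicit Defensive.
Import Order.TTheory GRing.Theory Num.Theory.
Local Open Scope ring_scope.

Section Defs.
Variables (R : realType) (n : nat).

Definition orthogonal_mx (U : 'M[R]_n) : Prop := U^T *m U = 1%:M.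

Definition unitarily_invariant_norm (N : 'M[R]_n -> R) : Prop :=
  [/\ (forall X, 0 <= N X),
      (forall X, N X = 0 -> X = 0),
      (forall (a : R) X, N (a *: X) = `|a| * N X),
      (forall X Y, N (X + Y) <= N X + N Y) &
      (forall U V X, orthogonal_mx U -> orthogonal_mx V ->
                     N (U *m X *m V) = N X)].

Definition poly_mx (p : {poly R}) (A : 'M[R]_n) : 'M[R]_n :=
  \sum_(i < size p) p`_i *: (A ^+ i).

(* 1-based eigenvalue with the convention lam_0 = -oo, lam_{n+1} = +oo
   (more generally lam_k = +oo for k > n). [lam] is 0-based on 'I_n. *)
Definition ext_eig (lam : 'I_n -> R) (k : nat) : \bar R :=
  if k is k'.+1 then
    (if insub k' is Some i then (lam i)%:E else +oo)%E
  else -oo%E.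

(* J = {j+1, ..., j+r} (1-based); 0-based i : 'I_n is in J iff j <= i < j+r *)
Definition Jset (j r : nat) : {set 'I_n} := [set i : 'I_n | (j <= i < j + r)%N].

(* the block [x_{j+1}, ..., x_{j+r}] of the columns of X (1-based) *)
Definition colblock (j r : nat) (X : 'M[R]_n) : 'M[R]_(n, r) :=
  \matrix_(a < n, k < r)
     (if insub (j + k)%N is Some i then X a i else 0).

Local Open Scope ereal_scope.

Definition Aset1 (j r : nat) (p : {poly R}) (phi : 'I_n -> R) (b : \bar R)
  : {set 'I_n} := [set i in ~: Jset j r | b < (p.[phi i])%:E].
Definition Aset2 (j r : nat) (p : {poly R}) (phi : 'I_n -> R) (a : \bar R)
  : {set 'I_n} := [set i in ~: Jset j r | (p.[phi i])%:E < a].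

Definition minp (S : {set 'I_n}) (p : {poly R}) (phi : 'I_n -> R) : \bar R :=
  \big[Order.min/+oo]_(i in S) (p.[phi i])%:E.
Definition maxp (S : {set 'I_n}) (p : {poly R}) (phi : 'I_n -> R) : \bar R :=
  \big[Order.max/-oo]_(i in S) (p.[phi i])%:E.

End Defs.

(* Main.v *)
(* In the eigenbases, with K = W^T V orthogonal and H = p(Phi) - Psi, the matrix
   W^T H V equals D K - K E with D = diag p(phi_i) and E = diag psi_i.  The spectra
   of the two compressions lie in an interval and at distance delta from it, so
   writing X = ((D - c) X - (D X - X E)) (E - c)^-1 with c the midpoint gives
   delta |1_J K 1_J^c| <= |H| in case (A) and delta |1_J^c K 1_J| <= |H| in case
   (B).  The two off-diagonal blocks of an orthogonal matrix have the same
   singular values, hence the same norm, which turns (B) into the claim. *)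
Require Import Defs.
From HB Require Import structures.
From mathcomp Require Import all_boot all_order all_algebra.
From mathcomp Require Import reals constructive_ereal.
From mathcomp Require Import perm.
From mathcomp Require Import complex ring lra.
Set Implicit Arguments. Unset Strict Implicit. Unset Printing Implicit Defensive.
Import Order.TTheory GRing.Theory Num.Theory.
Local Open Scope ring_scope.

(** * Dot product of row vectors and real eigenvectors of symmetric matrices *)

Definition dot (R : realType) (n : nat) (u v : 'rV[R]_n) : R := \sum_i u 0 i * v 0 i.

Lemma dotE (R : realType) n (u v : 'rV[R]_n) : u *m v^T = (dot u v)%:M.
Proof.
by rewrite [LHS]mx11_scalar mxE; congr _%:M; apply: eq_bigr => i _; rewrite mxE.
Qed.

Lemma dotC (R : realType) n (u v : 'rV[R]_n) : dot u v = dot v u.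
Proof. by apply: eq_bigr => i _; rewrite mulrC. Qed.

Lemma dotDl (R : realType) n (u v w : 'rV[R]_n) :
  dot (u + v) w = dot u w + dot v w.
Proof. by rewrite -big_split; apply: eq_bigr => i _; rewrite mxE mulrDl. Qed.

Lemma dotZl (R : realType) n a (u w : 'rV[R]_n) : dot (a *: u) w = a * dot u w.
Proof. by rewrite mulr_sumr; apply: eq_bigr => i _; rewrite mxE mulrA. Qed.

Lemma dotZr (R : realType) n a (u w : 'rV[R]_n) : dot u (a *: w) = a * dot u w.
Proof. by rewrite dotC dotZl dotC. Qed.

Lemma dotDr (R : realType) n (u v w : 'rV[R]_n) :
  dot u (v + w) = dot u v + dot u w.
Proof. by rewrite dotC dotDl !(dotC u). Qed.

Lemma dot_ge0 (R : realType) n (u : 'rV[R]_n) : 0 <= dot u u.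
Proof. by apply: sumr_ge0 => i _; rewrite -expr2 sqr_ge0. Qed.

Lemma dot_eq0 (R : realType) n (u : 'rV[R]_n) : (dot u u == 0) = (u == 0).
Proof.
apply/eqP/eqP => [/psumr_eq0P u0|->]; last first.
  by rewrite /dot big1 // => i _; rewrite mxE mul0r.
apply/rowP => i; rewrite mxE; apply/eqP.
rewrite -sqrf_eq0 expr2 u0 // => k _; by rewrite -expr2 sqr_ge0.
Qed.

Lemma dot_mulmx (R : realType) n (u v : 'rV[R]_n) (A : 'M_n) :
  dot (u *m A) v = dot u (v *m A^T).
Proof.
have /matrixP/(_ 0 0) : u *m A *m v^T = u *m (v *m A^T)^T.
  by rewrite trmx_mul trmxK mulmxA.
by rewrite !dotE !mxE /= !mulr1n.
Qed.

Lemma exists_unit (R : realType) n (P : 'rV[R]_n -> Prop) :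
  (forall a u, P u -> P (a *: u)) -> (exists2 u, u != 0 & P u) ->
  exists2 u, dot u u = 1 & P u.
Proof.
move=> PZ [u u0 Pu]; exists ((Num.sqrt (dot u u))^-1 *: u); last exact: PZ.
have s0 : Num.sqrt (dot u u) != 0.
  by rewrite sqrtr_eq0 -ltNge lt_def dot_eq0 u0 dot_ge0.
rewrite dotZl dotZr mulrA -expr2 exprVn sqr_sqrtr ?dot_ge0 //.
by rewrite mulVf // dot_eq0.
Qed.

(** Over the algebraically closed [R[i]] the characteristic polynomial has a root. Once symmetry
    makes that root real, the real and imaginary parts of a complex eigenvector satisfy the
    eigenvector equation separately, and one of them is nonzero. *)
Lemma symmetric_eigenvector (R : realType) n (A : 'M[R]_n.+1) :
  A^T = A -> exists2 v : 'rV_n.+1, v != 0 & exists a, v *m A = a *: v.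
Proof.
move=> AT; pose AC := map_mx (real_complex R) A.
have /closed_rootP[[al be]] : size (char_poly AC) != 1 by rewrite size_char_poly.
rewrite -eigenvalue_root_char => /eigenvalueP[v vA v0].
pose x := \row_i complex.Re (v 0 i); pose y := \row_i complex.Im (v 0 i).
have vAE i : \sum_k v 0 k * (real_complex R (A k i)) = (al +i* be)%C * v 0 i.
  by move/rowP: vA => /(_ i); rewrite !mxE => <-; apply: eq_bigr => k _; rewrite mxE.
have xA : x *m A = al *: x - be *: y.
  apply/rowP => i; rewrite !mxE.
  have /(congr1 (@complex.Re R)) := vAE i; rewrite raddf_sum /=.
  rewrite [X in _ = X]/=; case: (v 0 i) => p q /= <-.
  by apply: eq_bigr => k _; rewrite mxE; case: (v 0 k) => ? ? /=; rewrite mulr0 subr0.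
have yA : y *m A = al *: y + be *: x.
  apply/rowP => i; rewrite !mxE.
  have /(congr1 (@complex.Im R)) := vAE i; rewrite raddf_sum /=.
  rewrite [X in _ = X]/=; case: (v 0 i) => p q /= <-.
  by apply: eq_bigr => k _; rewrite mxE; case: (v 0 k) => ? ? /=; rewrite mulr0 add0r.
(* For x + i y an eigenvector of al + i be, <x A, y> = <x, y A> forces be = 0. *)
have := dot_mulmx x y A; rewrite AT xA yA -scaleNr dotDl dotDr !dotZl !dotZr => e.
have /eqP : be * (dot x x + dot y y) = 0 by lra.
have xy0 : (x != 0) || (y != 0).
  apply: contraNT v0; rewrite negb_or !negbK => /andP[/eqP x0 /eqP y0].
  apply/eqP/rowP => i; rewrite mxE; apply/eqP; rewrite eq_complex /=.
  by move/rowP: x0 => /(_ i); move/rowP: y0 => /(_ i); rewrite !mxE => -> ->; rewrite eqxx.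
rewrite mulf_eq0 paddr_eq0 ?dot_ge0 // !dot_eq0 -[_ && _]negbK negb_and xy0 orbF.
move=> /eqP be0; case/orP: xy0 => [x0|y0].
  by exists x => //; exists al; rewrite xA be0 scale0r subr0.
by exists y => //; exists al; rewrite yA be0 scale0r addr0.
Qed.

(** * Orthogonal matrices and the singular value decomposition *)

Lemma orthogonal_mx_tr (R : realType) n (U : 'M[R]_n) :
  orthogonal_mx U -> orthogonal_mx U^T.
Proof. by rewrite /orthogonal_mx trmxK => /mulmx1C. Qed.

Lemma orthogonal_mx_mul (R : realType) n (U V : 'M[R]_n) :
  orthogonal_mx U -> orthogonal_mx V -> orthogonal_mx (U *m V).
Proof.
rewrite /orthogonal_mx => UU VV.
by rewrite trmx_mul mulmxA -(mulmxA _ U^T) UU mulmx1.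
Qed.

Lemma orthogonal_mx1 (R : realType) n : orthogonal_mx (1%:M : 'M[R]_n).
Proof. by rewrite /orthogonal_mx trmx1 mulmx1. Qed.

(* The Householder reflection exchanging [v] and the first basis vector. *)
Lemma orthogonal_mx_row0 (R : realType) n (v : 'rV[R]_n.+1) :
  dot v v = 1 -> exists2 H : 'M_n.+1, orthogonal_mx H & row 0 H = v.
Proof.
move=> v1; pose e : 'rV[R]_n.+1 := delta_mx 0 0.
have [->|ve] := eqVneq v e.
  by exists 1%:M; [exact: orthogonal_mx1 | rewrite row1].
pose w := v - e.
have de u : dot e u = u 0 0.
  rewrite /dot big_ord_recl big1 => [|i _]; rewrite !mxE ?mul0r //.
  by rewrite !eqxx mul1r addr0.
have ww : dot w w = 2 - 2 * v 0 0.
  rewrite /w -scaleN1r dotDl !dotDr !dotZl !dotZr !de.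
  by rewrite v1 [dot _ e]dotC !de !mxE /=; ring.
have w0 : dot w w != 0 by rewrite dot_eq0 subr_eq0.
pose H := 1%:M - (2 / dot w w) *: (w^T *m w).
have HT : H^T = H.
  apply/matrixP => i k; rewrite !mxE !big_ord1 !mxE.
  by congr (_%:R - _ * _); [rewrite eq_sym | rewrite mulrC].
have wH : w *m H = - w.
  rewrite mulmxBr mulmx1 -scalemxAr mulmxA dotE mul_scalar_mx scalerA mulfVK //.
  by rewrite scaler_nat mulr2n opprD addrA subrr sub0r.
exists H.
  rewrite /orthogonal_mx HT {1}/H mulmxBl mul1mx -scalemxAl -mulmxA wH.
  by rewrite mulmxN scalerN opprK subrK.
rewrite rowE /H mulmxBr mulmx1 -scalemxAr mulmxA dotE mul_scalar_mx scalerA de ww.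
(* Since [dot w w] is twice [1 - v 0 0] and [w 0 0] is [v 0 0 - 1], the reflection sends [e] to
   [e + w], that is, to [v]. *)
have -> : 2 / (2 - 2 * v 0 0) * w 0 0 = -1.
  move: w0; rewrite ww !mxE /= => w0.
  rewrite mulrAC; apply/eqP; rewrite -(inj_eq (mulIf w0)) mulfVK //.
  by apply/eqP; ring.
by rewrite scaleN1r opprK addrC subrK.
Qed.

(** Take for [v] a unit eigenvector of the symmetric matrix [A *m A^T] and for [u] the normalised
    image [v *m A]. The pair splits one dimension off in the induction for [svd]. *)
Lemma singular_pair (R : realType) n (A : 'M[R]_n.+1) : exists u v : 'rV_n.+1,
  [/\ dot u u = 1, dot v v = 1 &
      exists s t, v *m A = s *: u /\ u *m A^T = t *: v].
Proof.
have [v v1 [a vA]] : exists2 v : 'rV_n.+1, dot v v = 1 &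
    exists a, v *m (A *m A^T) = a *: v.
  apply: exists_unit; last by apply: symmetric_eigenvector; rewrite trmx_mul trmxK.
  by move=> c u [a ua]; exists a; rewrite -scalemxAl ua !scalerA mulrC.
pose w := v *m A.
have [w0|w0] := eqVneq w 0.
  have v0 : v != 0 by rewrite -dot_eq0 v1 oner_eq0.
  (* If [v *m A = 0] then [A] is singular, hence so is [A^T]; any unit vector of its kernel serves
     as [u], with both scalars zero. *)
  have [u u1 uA] : exists2 u : 'rV_n.+1, dot u u = 1 & u *m A^T = 0.
    apply: exists_unit => [c u uA|]; first by rewrite -scalemxAl uA scaler0.
    by apply/det0P; rewrite det_tr; apply/det0P; exists v.
  exists u, v; split=> //; exists 0, 0; rewrite !scale0r; split=> //.
pose s := Num.sqrt (dot w w).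
have s0 : s != 0 by rewrite sqrtr_eq0 -ltNge lt_def dot_eq0 w0 dot_ge0.
exists (s^-1 *: w), v; split=> //.
  rewrite dotZl dotZr mulrA -expr2 exprVn sqr_sqrtr ?dot_ge0 //.
  by rewrite mulVf // dot_eq0.
exists s, (s^-1 * a); split; first by rewrite scalerA divff // scale1r.
by rewrite -scalemxAl /w -mulmxA vA scalerA.
Qed.

(** Reflections carrying a singular pair to the first basis vector clear the first row and column
    off the corner, and the induction hypothesis diagonalises the remaining block. The diagonal
    entries may have either sign: only their squares matter later. *)
Lemma svd (R : realType) n (A : 'M[R]_n) : exists U V (s : 'rV_n),
  [/\ orthogonal_mx U, orthogonal_mx V & U *m A *m V = diag_mx s].
Proof.
elim: n A => [|n IHn] A.
  exists 1%:M, 1%:M, 0; split; try exact: orthogonal_mx1.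
  by rewrite [LHS]flatmx0 [RHS]flatmx0.
have [u [v [u1 v1 [s [t [vA uA]]]]]] := singular_pair A.
have [Hu Ou Hu0] := orthogonal_mx_row0 u1.
have [Hv Ov Hv0] := orthogonal_mx_row0 v1.
pose B : 'M_(1 + n) := Hv *m A *m Hu^T.
(* Row 0 of [B] is [v *m A *m Hu^T], a multiple of [u *m Hu^T], which is the first basis vector;
   column 0 is treated in the same way through [B^T]. *)
have B0r i : B 0 i = s *+ (0 == i).
  have : row 0 B = s *: delta_mx 0 0.
    rewrite /B !row_mul Hv0 vA -scalemxAl -Hu0 -row_mul.
    by move/orthogonal_mx_tr: Ou; rewrite /orthogonal_mx trmxK => ->; rewrite row1.
  by move/rowP/(_ i); rewrite !mxE eqxx /= eq_sym mulr_natr.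
have Bc0 i : B i 0 = t *+ (0 == i).
  have : row 0 B^T = t *: delta_mx 0 0.
    rewrite /B !trmx_mul trmxK mulmxA !row_mul Hu0 uA -scalemxAl -Hv0 -row_mul.
    by move/orthogonal_mx_tr: Ov; rewrite /orthogonal_mx trmxK => ->; rewrite row1.
  by move/rowP/(_ i); rewrite !mxE eqxx /= eq_sym mulr_natr.
have [U [V [d [OU OV UV]]]] := IHn (drsubmx B).
have l0 : lshift n (0 : 'I_1) = 0 :> 'I_n.+1 by apply/val_inj.
have BE : B = block_mx s%:M 0 0 (drsubmx B).
  rewrite -[LHS]submxK; clearbody B.
  congr block_mx; apply/matrixP => i k; rewrite !mxE.
  - by rewrite !ord1 l0 B0r.
  - by rewrite !ord1 l0 B0r.
  - by rewrite !ord1 l0 Bc0.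
pose bl a (X : 'M[R]_n) : 'M[R]_n.+1 := block_mx (a%:M : 'M_1) 0 0 X.
have blM a X b Y : bl a X *m bl b Y = bl (a * b) (X *m Y).
  have := mulmx_block (a%:M : 'M[R]_1) 0 0 X (b%:M : 'M_1) 0 0 Y.
  by rewrite !mul0mx !mulmx0 !addr0 add0r -scalar_mxM.
have blk X : orthogonal_mx X -> orthogonal_mx (bl 1 X).
  rewrite /orthogonal_mx => XX; have -> : (bl 1 X)^T = bl 1 X^T.
    by have := tr_block_mx (1%:M : 'M[R]_1) 0 0 X; rewrite !trmx0 trmx1.
  by rewrite blM XX mulr1 /bl -(scalar_mx_block 1 n).
exists (bl 1 U *m Hv), (Hu^T *m bl 1 V), (row_mx (const_mx s : 'rV_1) d); split.
- by apply: orthogonal_mx_mul => //; exact: blk.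
- by apply: orthogonal_mx_mul; [exact: orthogonal_mx_tr | exact: blk].
have -> : bl 1 U *m Hv *m A *m (Hu^T *m bl 1 V) = bl 1 U *m B *m bl 1 V.
  by rewrite /B !mulmxA.
rewrite (BE : B = bl s _) !blM mul1r mulr1 UV /bl.
have -> : s%:M = diag_mx (const_mx s : 'rV_1).
  by apply/matrixP => i k; rewrite !ord1 !mxE.
have /esym e := diag_mx_row (const_mx s : 'rV[R]_1) d; exact: e.
Qed.

(** If [U *m A *m V] is diagonal, then [U] diagonalises [A *m A^T] and [V^T] diagonalises
    [A^T *m A], with the same squared entries, so [V *m U] carries one Gram matrix to the other. *)
Lemma gram_similar (R : realType) n (A : 'M[R]_n) :
  exists2 M, orthogonal_mx M & A^T *m A = M *m (A *m A^T) *m M^T.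
Proof.
have [U [V [s [OU OV UV]]]] := svd A.
have OU' := orthogonal_mx_tr OU; have OV' := orthogonal_mx_tr OV.
move: (OU) (OV) (OU') (OV'); rewrite /orthogonal_mx !trmxK => UU VV UU' VV'.
exists (V *m U); first exact: orthogonal_mx_mul.
have AE : A = U^T *m diag_mx s *m V^T.
  by rewrite -UV !mulmxA UU mul1mx -!mulmxA VV' mulmx1.
have AtE : A^T = V *m diag_mx s *m U.
  by rewrite AE !trmx_mul !trmxK tr_diag_mx !mulmxA.
rewrite AtE AE trmx_mul !mulmxA.
rewrite -(mulmxA _ U U^T) UU' mulmx1 -(mulmxA V U U^T) UU' mulmx1.
by rewrite -(mulmxA _ V^T V) VV mulmx1 -(mulmxA _ U U^T) UU' mulmx1.
Qed.

Lemma char_poly_orthogonal (R : realType) n (U A : 'M[R]_n) :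
  orthogonal_mx U -> char_poly (U *m A *m U^T) = char_poly A.
Proof.
move=> /orthogonal_mx_tr; rewrite /orthogonal_mx trmxK => UU.
have {}UU : map_mx polyC U *m map_mx polyC U^T = 1%:M.
  by rewrite -map_mxM UU map_scalar_mx.
rewrite /char_poly.
have -> : char_poly_mx (U *m A *m U^T) =
    map_mx polyC U *m char_poly_mx A *m map_mx polyC U^T.
  rewrite /char_poly_mx !map_mxM mulmxBr mulmxBl; congr (_ - _).
  by rewrite scalar_mxC -mulmxA UU mulmx1.
by rewrite !det_mulmx mulrAC -det_mulmx UU det1 mul1r.
Qed.

(** * Coordinate projections and unitarily invariant norms *)

Definition set_proj (R : realType) n (S : {set 'I_n}) : 'M[R]_n :=
  diag_mx (\row_i (i \in S)%:R).

Section UnitarilyInvariantNorm.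
Variables (R : realType) (n : nat) (N : 'M[R]_n -> R).
Hypothesis uiN : unitarily_invariant_norm N.

Lemma uinorm_ge0 X : 0 <= N X. Proof. by case: uiN. Qed.

Lemma uinormZ a X : N (a *: X) = `|a| * N X. Proof. by case: uiN. Qed.

Lemma uinormD X Y : N (X + Y) <= N X + N Y. Proof. by case: uiN. Qed.

Lemma uinorm0 : N 0 = 0.
Proof. by rewrite -(scale0r 0) uinormZ normr0 mul0r. Qed.

Lemma uinormN X : N (- X) = N X.
Proof. by rewrite -scaleN1r uinormZ normrN1 mul1r. Qed.

Lemma uinormM U V X : orthogonal_mx U -> orthogonal_mx V -> N (U *m X *m V) = N X.
Proof. by case: uiN => ? ? ? ?; apply. Qed.

Lemma uinorm_mull U X : orthogonal_mx U -> N (U *m X) = N X.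
Proof.
by move=> OU; rewrite -[U *m X]mulmx1 uinormM //; exact: orthogonal_mx1.
Qed.

Lemma orthogonal_diag_sign (d : 'rV[R]_n) :
  (forall i, `|d 0 i| = 1) -> orthogonal_mx (diag_mx d).
Proof.
move=> d1; rewrite /orthogonal_mx tr_diag_mx mulmx_diag -diag_const_mx.
congr diag_mx; apply/rowP => i; rewrite !mxE -expr2.
by rewrite -[_ ^+ 2]real_normK ?num_real // d1 expr1n.
Qed.

(* A diagonal matrix with entries in [[-1, 1]] is a convex combination of
   diagonal sign matrices; the entries are moved to [1] or [-1] one at a time. *)
Lemma uinorm_diag_le1 (d : 'rV[R]_n) X :
  (forall i, `|d 0 i| <= 1) -> N (diag_mx d *m X) <= N X.
Proof.
(* Induction on [m], the entries of index at least [m] being signs already; [m = n] is the claim and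
   [m = 0] is the orthogonal case. *)
suff H m : forall d : 'rV[R]_n, (forall i, `|d 0 i| <= 1) ->
    (forall i : 'I_n, (m <= i)%N -> `|d 0 i| = 1) -> N (diag_mx d *m X) <= N X.
  by move=> d1; apply: (H n) => // i; rewrite leqNgt ltn_ord.
elim: m {d} => [|m IHm] d d1 dm.
  by rewrite uinorm_mull //; apply: orthogonal_diag_sign => i; exact: dm.
have [nm|mn] := leqP n m.
  by apply: IHm => // i; rewrite leqNgt (leq_trans (ltn_ord i) nm).
pose k := Ordinal mn; pose t := d 0 k.
pose s a : 'rV[R]_n := \row_i if i == k then a else d 0 i.
have dE : diag_mx d = ((1 + t) / 2) *: diag_mx (s 1) + ((1 - t) / 2) *: diag_mx (s (-1)).
  apply/matrixP => i j; rewrite !mxE; case: (i =P j) => _; last by rewrite !mulr0 addr0.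
  rewrite !mulr1n; case: eqP => [->|_]; rewrite -/t; by field.
have sP a : `|a| = 1 -> N (diag_mx (s a) *m X) <= N X.
  move=> a1; apply: IHm => i; rewrite mxE; case: eqP => [//|]; rewrite ?a1 //.
  by move=> ik; rewrite leq_eqVlt => /orP[/eqP mi|/dm //]; case: ik; apply/val_inj.
have /ler_normlP[t1 t2] := d1 k.
rewrite dE mulmxDl -!scalemxAl (le_trans (uinormD _ _)) // !uinormZ.
rewrite !ger0_norm; try by rewrite /t; lra.
apply: (@le_trans _ _ ((1 + t) / 2 * N X + (1 - t) / 2 * N X)); last by lra.
by apply: lerD; apply: ler_wpM2l; rewrite ?sP ?normrN1 ?normr1 // /t; lra.
Qed.

Lemma uinorm_diag_mull c (d : 'rV[R]_n) X :
  0 <= c -> (forall i, `|d 0 i| <= c) -> N (diag_mx d *m X) <= c * N X.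
Proof.
rewrite le_eqVlt => /orP[/eqP <-|c0] dc.
  have -> : d = 0 by apply/rowP => i; apply/eqP; rewrite mxE -normr_le0 dc.
  by rewrite raddf0 mul0mx uinorm0 mul0r.
have -> : d = c *: (c^-1 *: d) by rewrite scalerA divff ?scale1r // gt_eqF.
rewrite linearZ -scalemxAl uinormZ gtr0_norm // ler_pM2l //.
apply: uinorm_diag_le1 => i; rewrite mxE normrM gtr0_norm ?invr_gt0 //.
by rewrite mulrC ler_pdivrMr // mul1r.
Qed.

(** Equal multisets of squares mean that the entries agree up to a permutation and signs, both of
    which are realised by orthogonal factors. *)
Lemma uinorm_diag_perm (d e : 'rV[R]_n) :
  perm_eq [seq d 0 i ^+ 2 | i : 'I_n] [seq e 0 i ^+ 2 | i : 'I_n] ->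
  N (diag_mx d) = N (diag_mx e).
Proof.
move=> de.
have /tuple_permP[s sE] : perm_eq [tuple d 0 i ^+ 2 | i < n] [tuple e 0 i ^+ 2 | i < n].
  exact: de.
have {}sE i : d 0 i ^+ 2 = e 0 (s i) ^+ 2.
  by have /(congr1 (fun t => tnth t i)) := val_inj sE; rewrite !tnth_mktuple.
(* The sign is -1 exactly where the entries differ; equality of the squares then forces them to be
   opposite. *)
pose g : 'rV[R]_n := \row_i (-1) ^+ (d 0 i != e 0 (s i)).
have -> : diag_mx d = diag_mx g *m (perm_mx s *m diag_mx e *m (perm_mx s)^T).
  rewrite tr_perm_mx -row_permE -col_permE mul_diag_mx.
  apply/matrixP => i k; rewrite !mxE (inj_eq perm_inj).
  case: (i =P k) => [_|]; last by rewrite mulr0.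
  rewrite !mulr1n; case: eqP => [->|]; first by rewrite mul1r.
  by have /eqP := sE i; rewrite eqf_sqr => /orP[/eqP ->//|/eqP -> _]; rewrite mulN1r.
have Os : orthogonal_mx (perm_mx s : 'M[R]_n).
  by rewrite /orthogonal_mx tr_perm_mx -perm_mxM mulVg perm_mx1.
rewrite uinorm_mull ?uinormM //; first exact: orthogonal_mx_tr.
by apply: orthogonal_diag_sign => i; rewrite mxE normr_sign.
Qed.

(** By [svd], the norm depends only on the squared singular values, and these are recovered with
    multiplicity as the roots of the characteristic polynomial of the Gram matrix. *)
Lemma uinorm_char_poly X Y :
  char_poly (X *m X^T) = char_poly (Y *m Y^T) -> N X = N Y.
Proof.
suff svdN Z : exists s, N Z = N (diag_mx s) /\
    char_poly (Z *m Z^T) = \prod_(x <- [seq s 0 i ^+ 2 | i : 'I_n]) ('X - x%:P).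
  have [s [-> ->]] := svdN X; have [t [-> ->]] := svdN Y.
  by move/prod_XsubC_eq/uinorm_diag_perm.
have [U [V [s [OU OV UV]]]] := svd Z.
exists s; split; first by rewrite -UV uinormM.
rewrite -(char_poly_orthogonal _ OU).
have -> : U *m (Z *m Z^T) *m U^T = diag_mx (\row_i s 0 i ^+ 2).
  have <- : diag_mx s *m (diag_mx s)^T = diag_mx (\row_i s 0 i ^+ 2).
    by rewrite tr_diag_mx mulmx_diag.
  move/orthogonal_mx_tr: OV; rewrite /orthogonal_mx trmxK => VV.
  by rewrite -UV !trmx_mul !mulmxA -(mulmxA _ V) VV mulmx1.
rewrite char_poly_trig ?diag_mx_is_trig // big_image /=.
by apply: eq_bigr => i _; rewrite !mxE eqxx.
Qed.

(** This transfers the bounds for left factors to right factors. *)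
Lemma uinorm_trmx X : N X^T = N X.
Proof.
apply: uinorm_char_poly; have [M OM] := gram_similar X.
by rewrite trmxK => ->; exact: char_poly_orthogonal.
Qed.

(* With Q = 1 - P and G = P K P + Q, the Gram matrices of P K Q and of the
   transpose of Q K P are 1 - G G^T and 1 - G^T G, which are orthogonally similar. *)
Lemma uinorm_off_diagonal (K P : 'M[R]_n) :
  orthogonal_mx K -> P^T = P -> P *m P = P ->
  N (P *m K *m (1%:M - P)) = N ((1%:M - P) *m K *m P).
Proof.
move=> OK PT PP; set Q := 1%:M - P.
have QT : Q^T = Q by rewrite /Q raddfB /= trmx1 PT.
have PQ : P *m Q = 0 by rewrite mulmxBr mulmx1 PP subrr.
have QP : Q *m P = 0 by rewrite mulmxBl mul1mx PP subrr.
have QQ : Q *m Q = Q by rewrite {1}/Q mulmxBl mul1mx PQ subr0.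
have QE : Q = 1%:M - P by [].
(* The identity is kept general in [L] because it is applied to both [K] and [K^T]. It rests on
   [P *m L *m L^T *m P = P = 1%:M - Q]. *)
clearbody Q; have gram (L : 'M_n) : L *m L^T = 1%:M -> (P *m L *m Q) *m (P *m L *m Q)^T =
    1%:M - (P *m L *m P + Q) *m (P *m L *m P + Q)^T.
  move=> LL; have -> : (P *m L *m P + Q)^T = P *m L^T *m P + Q.
    by rewrite [LHS]raddfD /= !trmx_mul PT QT mulmxA.
  rewrite mulmxDl !mulmxDr QQ -(mulmxA (P *m L) P Q) PQ mulmx0 addr0.
  rewrite (mulmxA Q) (mulmxA Q) QP !mul0mx add0r opprD.
  rewrite !trmx_mul PT QT !mulmxA -(mulmxA _ Q Q) QQ -(mulmxA _ P P) PP.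
  rewrite {1}QE mulmxBr mulmx1 !mulmxBl -(mulmxA P L L^T) LL mulmx1 PP.
  by rewrite QE opprB [RHS]addrCA [1%:M + _]addrC subrK addrC.
have [M OM GM] := gram_similar (P *m K *m P + Q).
rewrite -[RHS]uinorm_trmx; apply: uinorm_char_poly.
have KK : K *m K^T = 1%:M by move/orthogonal_mx_tr: OK; rewrite /orthogonal_mx trmxK.
have -> : (Q *m K *m P)^T = P *m K^T *m Q by rewrite !trmx_mul PT QT mulmxA.
rewrite (gram K KK) (gram K^T); last by rewrite trmxK.
have -> : P *m K^T *m P + Q = (P *m K *m P + Q)^T.
  by rewrite [RHS]raddfD /= !trmx_mul PT QT mulmxA.
rewrite trmxK GM -(char_poly_orthogonal (1%:M - _) OM); congr char_poly.
move/orthogonal_mx_tr: OM; rewrite /orthogonal_mx trmxK => MM.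
by rewrite mulmxBr mulmx1 mulmxBl MM.
Qed.

(** Solving for [X] with the shift [c] gives [N X <= (rho * N X + N Y) / (rho + delta)], where [Y]
    is the Sylvester difference; absorbing the [rho] term leaves the factor [delta]. *)
Lemma sylvester_bound (d e : 'rV[R]_n) c rho delta X :
  0 <= rho -> 0 < delta ->
  (forall i, `|d 0 i - c| <= rho) -> (forall i, rho + delta <= `|e 0 i - c|) ->
  delta * N X <= N (diag_mx d *m X - X *m diag_mx e).
Proof.
move=> rho0 delta0 dc ec.
set Y := _ - _; pose f : 'rV[R]_n := \row_i (e 0 i - c)^-1.
have rd0 : 0 < rho + delta by lra.
have e0 i : e 0 i - c != 0 by rewrite -normr_gt0 (lt_le_trans rd0).
have XE : X = (diag_mx (\row_i (d 0 i - c)) *m X - Y) *m diag_mx f.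
  apply/matrixP => i k; rewrite /Y !mul_mx_diag !mul_diag_mx !mxE.
  by apply: (mulIf (e0 k)); rewrite mulfVK //; ring.
have : N X <= (rho + delta)^-1 * (rho * N X + N Y).
  (* Transposing brings the right factor [diag_mx f] to the left, where its entries are at most
     [(rho + delta)^-1] in absolute value. *)
  rewrite {1}XE -uinorm_trmx trmx_mul tr_diag_mx.
  apply: le_trans (@uinorm_diag_mull (rho + delta)^-1 _ _ _ _) _ => [|i|].
  - by rewrite invr_ge0 ltW.
  - by rewrite mxE normfV lef_pV2 // posrE normr_gt0.
  rewrite ler_pM2l ?invr_gt0 // uinorm_trmx.
  rewrite (le_trans (uinormD _ _)) // uinormN lerD2r.
  by apply: uinorm_diag_mull => // i; rewrite mxE.
by rewrite mulrC ler_pdivlMr //; lra.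
Qed.

(** Apply [sylvester_bound] to the compression of [K], with [c] the midpoint and [rho] the
    half-length of the interval. Diagonal matrices commute with coordinate projections, so the
    Sylvester difference of the compression is the compression of the difference, and compressing
    does not increase the norm. *)
Lemma davis_kahan (S T : {set 'I_n}) (K : 'M[R]_n) (d e : 'rV[R]_n) a b delta :
  a <= b -> 0 < delta -> (forall i, i \in S -> a <= d 0 i <= b) ->
  (forall k, k \in T -> e 0 k + delta <= a \/ b + delta <= e 0 k) ->
  delta * N (set_proj R S *m K *m set_proj R T) <=
  N (diag_mx d *m K - K *m diag_mx e).
Proof.
move=> ab delta0 dS eT; pose c := (a + b) / 2; pose rho := (b - a) / 2.
(* Off [S] and [T] the diagonal entries do not matter and are set harmlessly. *)
pose d' : 'rV[R]_n := \row_i if i \in S then d 0 i else c.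
pose e' : 'rV[R]_n := \row_k if k \in T then e 0 k else c + rho + delta.
set X := _ *m K *m _.
have rho0 : 0 <= rho by rewrite /rho; lra.
have contr (U : {set 'I_n}) Z : N (set_proj R U *m Z) <= N Z.
  apply: uinorm_diag_le1 => i; rewrite mxE.
  by case: (i \in U); rewrite ?normr1 ?normr0.
have XE : diag_mx d' *m X - X *m diag_mx e' =
    set_proj R S *m (diag_mx d *m K - K *m diag_mx e) *m set_proj R T.
  apply/matrixP => i k; rewrite /X /set_proj !mul_mx_diag !mul_diag_mx !mxE.
  by case: (i \in S); case: (k \in T); rewrite !(mulr0n, mulr1n, mul0r, mulr0, mul1r, mulr1, subrr).
apply: le_trans (sylvester_bound (d := d') (e := e') (c := c) X rho0 delta0 _ _) _.
- move=> i; rewrite mxE; case: ifP => [/dS /andP[ai bi]|_].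
    by rewrite ler_norml /c /rho; apply/andP; split; lra.
  by rewrite subrr normr0.
- move=> k; rewrite mxE; case: ifP => [/eT[ke|ke]|_]; rewrite ler_normr /c /rho;
    apply/orP; by [left; lra | right; lra].
rewrite XE -uinorm_trmx trmx_mul [X in X *m _]tr_diag_mx.
by rewrite (le_trans (contr T _)) // uinorm_trmx contr.
Qed.
End UnitarilyInvariantNorm.

(** * Spectral projections and matrix polynomials in an eigenbasis *)

Lemma tr_set_proj (R : realType) n (S : {set 'I_n}) :
  (set_proj R S)^T = set_proj R S.
Proof. exact: tr_diag_mx. Qed.

Lemma set_proj_idem (R : realType) n (S : {set 'I_n}) :
  set_proj R S *m set_proj R S = set_proj R S.
Proof.
by rewrite mulmx_diag; congr diag_mx; apply/rowP => i; rewrite !mxE -natrM mulnb andbb.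
Qed.

Lemma set_projC (R : realType) n (S : {set 'I_n}) :
  set_proj R (~: S) = 1%:M - set_proj R S.
Proof.
apply/matrixP => i k; rewrite !mxE inE; case: (i == k); last by rewrite subr0.
by case: (i \in S); rewrite ?subrr ?subr0.
Qed.

Lemma colblock_proj (R : realType) n j r (W : 'M[R]_n) : (j + r <= n)%N ->
  colblock j r W *m (colblock j r W)^T = W *m set_proj R (Jset n j r) *m W^T.
Proof.
move=> jrn; apply/matrixP => a b; rewrite mul_mx_diag !mxE.
(* Extending the summand by 0 to all natural numbers allows shifting the range by [j] and cutting it
   at [j] and [j + r]. *)
pose f k := if insub k is Some i then W a i * W b i else 0.
transitivity (\sum_(k < r) f (j + k)%N).
  apply: eq_bigr => k _; rewrite !mxE /f.
  by case: insubP => // _; rewrite mul0r.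
transitivity (\sum_(i < n | (j <= i < j + r)%N) f i); last first.
  rewrite [LHS]big_mkcond; apply: eq_bigr => i _; rewrite !mxE inE /f valK.
  by case: ifP => _; rewrite ?mulr1 // mulr0 mul0r.
rewrite -(big_mkord xpredT (fun k => f (j + k)%N)).
rewrite -(big_mkord (fun i => j <= i < j + r)%N f).
have hi : \sum_(j + r <= i < n | (j <= i < j + r)%N) f i = 0.
  rewrite big_nat_cond big1 // => i /andP[/andP[ji _] /andP[_ ij]].
  by rewrite leqNgt ij in ji.
have lo : \sum_(0 <= i < j | (j <= i < j + r)%N) f i = 0.
  rewrite big_nat_cond big1 // => i /andP[/andP[_ ij] /andP[ji _]].
  by rewrite leqNgt ij in ji.
rewrite [RHS](@big_cat_nat _ _ _ (j + r)) //= hi addr0.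
rewrite [RHS](@big_cat_nat _ _ _ j) ?leq_addr //= lo add0r.
rewrite -[X in _ = \sum_(X <= _ < _ | _) _]add0n big_addn addKn [RHS]big_nat_cond [LHS]big_nat_cond.
apply: eq_big => [i|i _]; last by rewrite addnC.
by case: (ltnP i r) => //= ir; rewrite leq_addl addnC ltn_add2l ir.
Qed.

Lemma poly_mx_eigen (R : realType) n (A W : 'M[R]_n) (lam : 'I_n -> R) p :
  (forall i, A *m col i W = lam i *: col i W) ->
  poly_mx p A *m W = W *m diag_mx (\row_i p.[lam i]).
Proof.
move=> AW; apply/matrixP => a i; rewrite mul_mx_diag !mxE.
have Ak k : A ^+ k *m col i W = lam i ^+ k *: col i W.
  elim: k => [|k IHk]; first by rewrite !expr0 mul1mx scale1r.
  by rewrite exprSr -mulmxA AW -scalemxAr IHk scalerA -exprS.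
have : col i (poly_mx p A *m W) = p.[lam i] *: col i W.
  rewrite !colE -mulmxA -colE /poly_mx mulmx_suml horner_coef scaler_suml.
  by apply: eq_bigr => k _; rewrite -scalemxAl Ak scalerA.
by move/colP/(_ a); rewrite !mxE => ->; rewrite mulrC.
Qed.

Lemma mx_eigen (R : realType) n (A W : 'M[R]_n) (lam : 'I_n -> R) :
  (forall i, A *m col i W = lam i *: col i W) ->
  A *m W = W *m diag_mx (\row_i lam i).
Proof.
move=> AW; apply/matrixP => a i; rewrite mul_mx_diag !mxE.
by move: (AW i); rewrite !colE mulmxA -!colE => /colP/(_ a); rewrite !mxE => ->; rewrite mulrC.
Qed.

(** * Extended-real gaps, eigenvalues and extrema *)

Section Ereal.
Variable R : realType.
Local Open Scope ereal_scope.

(** This reduces the final estimate to real gaps below [delta]. The value +oo does occur, when [J]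
    contains every index; the quotient is then 0 and [x] must vanish. *)
Lemma lee_div_bound (x y : R) (delta : \bar R) : (0 <= x)%R -> 0 < delta ->
  (forall d, (0 < d)%R -> d%:E <= delta -> (d * x <= y)%R) ->
  x%:E <= y%:E / delta.
Proof.
move=> x0; case: delta => [d|_ H|//].
  rewrite lte_fin => d0 H; rewrite inver gt_eqF // -EFinM lee_fin.
  by rewrite ler_pdivlMr // mulrC; apply: H.
have y0 : (0 <= y)%R by apply: le_trans (H 1%R _ _); rewrite ?mul1r ?leey.
rewrite invey mule0 lee_fin leNgt; apply/negP => xgt0.
(* For [x > 0], the real gap [(y + 1) / x] would give [y + 1 <= y]. *)
have /H : (0 < (y + 1) / x)%R by rewrite divr_gt0 // ltr_wpDl.
by rewrite leey => /(_ isT); rewrite mulfVK ?gt_eqF // leNgt ltrDl ltr01.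
Qed.

(** One term of [delta1] or [delta2] becomes a separation between real numbers: either infinite
    value of [X] contradicts one of the two hypotheses. *)
Lemma lee_sub_gap (d b t : R) (X : \bar R) :
  d%:E <= X - b%:E -> X <= t%:E -> (b + d <= t)%R.
Proof. by case: X => [x||] //=; rewrite !lee_fin; lra. Qed.

Lemma lee_gap_sub (d a t : R) (Y : \bar R) :
  d%:E <= a%:E - Y -> t%:E <= Y -> (t + d <= a)%R.
Proof. by case: Y => [y||] //=; rewrite !lee_fin; lra. Qed.

Variables (n : nat).
Implicit Types (lam : 'I_n -> R) (S : {set 'I_n}).

(** Here [i] is 0-based and [k] is 1-based, so [i < k] places [lam i] at or before position [k];
    beyond [n] the convention +oo applies. *)
Lemma ext_eig_ge lam (i : 'I_n) k :
  (forall i k : 'I_n, (i <= k)%N -> (lam i <= lam k)%R) ->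
  (i < k)%N -> (lam i)%:E <= ext_eig lam k.
Proof.
move=> lam_mono; case: k => // k ik /=; case: insubP => [m _ mk|_]; last exact: leey.
by rewrite lee_fin lam_mono // mk.
Qed.

Lemma ext_eig_le lam (i : 'I_n) k :
  (forall i k : 'I_n, (i <= k)%N -> (lam i <= lam k)%R) ->
  (k <= i.+1)%N -> ext_eig lam k <= (lam i)%:E.
Proof.
move=> lam_mono; case: k => [|k ki /=]; first by rewrite leNye.
case: insubP => [m _ mk|]; first by rewrite lee_fin lam_mono // mk.
by rewrite (leq_ltn_trans _ (ltn_ord i)).
Qed.

Lemma ext_eig_fin lam k (kn : (k < n)%N) :
  ext_eig lam k.+1 = (lam (Ordinal kn))%:E.
Proof. by rewrite /= insubT. Qed.

Lemma minp_le S p lam i : i \in S -> minp S p lam <= (p.[lam i])%:E.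
Proof. exact: bigmin_le_cond. Qed.

Lemma maxp_ge S p lam i : i \in S -> (p.[lam i])%:E <= maxp S p lam.
Proof. exact: le_bigmax_cond. Qed.

Lemma minp_fin S p lam i : i \in S -> exists a, minp S p lam = a%:E.
Proof.
move=> iS; have := minp_le p lam iS.
have : minp S p lam != -oo.
  by rewrite /minp; elim/big_ind: _ => // x y; rewrite minEle; case: ifP.
by case: (minp S p lam) => [a|//|//]; exists a.
Qed.

Lemma maxp_fin S p lam i : i \in S -> exists b, maxp S p lam = b%:E.
Proof.
move=> iS; have := maxp_ge p lam iS.
have : maxp S p lam != +oo.
  by rewrite /maxp; elim/big_ind: _ => // x y; rewrite maxEle; case: ifP.
by case: (maxp S p lam) => [a|//|//]; exists a.
Qed.
End Ereal.

(** * The perturbation bound for spectral projections *)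

Unset Implicit Arguments.

Theorem theorem5 (R : realType) (n : nat)
  (Phi Psi : 'M[R]_n) (phi psi : 'I_n -> R) (W V : 'M[R]_n)
  (j r : nat) (p : {poly R}) :
  Phi^T = Phi -> Psi^T = Psi ->
  (forall i k : 'I_n, (i <= k)%N -> phi i <= phi k) ->
  (forall i k : 'I_n, (i <= k)%N -> psi i <= psi k) ->
  W^T *m W = 1%:M -> V^T *m V = 1%:M ->
  (forall i : 'I_n, Phi *m col i W = phi i *: col i W) ->
  (forall i : 'I_n, Psi *m col i V = psi i *: col i V) ->
  (1 <= r)%N -> (j + r <= n)%N ->
  (ext_eig phi j < ext_eig phi j.+1)%E ->
  (ext_eig phi (j + r) < ext_eig phi (j + r).+1)%E ->
  (ext_eig psi j < ext_eig psi j.+1)%E ->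
  (ext_eig psi (j + r) < ext_eig psi (j + r).+1)%E ->
  let J := Jset n j r in
  let a1 := minp J p phi in
  let b1 := maxp J p phi in
  let delta1 := Order.min (ext_eig psi (j + r).+1 - b1)%E (a1 - ext_eig psi j)%E in
  let a2 := ext_eig psi j.+1 in
  let b2 := ext_eig psi (j + r) in
  let delta2 := Order.min (minp (Aset1 j r p phi b2) p phi - b2)%E
                          (a2 - maxp (Aset2 j r p phi a2) p phi)%E in
  forall delta : \bar R,
  ((Aset1 j r p phi b1 :|: Aset2 j r p phi a1 = ~: J /\
    (0 < delta1)%E /\ (a1 - ext_eig psi j.+1 < delta1)%E /\
    (ext_eig psi (j + r) - b1 < delta1)%E /\ delta = delta1) \/
   (Aset1 j r p phi b2 :|: Aset2 j r p phi a2 = ~: J /\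
    (0 < delta2)%E /\ (a2 - minp J p phi < delta2)%E /\
    (maxp J p phi - b2 < delta2)%E /\ delta = delta2)) ->
  let Wj := colblock j r W in
  let Vj := colblock j r V in
  forall N : 'M[R]_n -> R, unitarily_invariant_norm N ->
  ((N (Wj *m Wj^T *m (1%:M - Vj *m Vj^T)))%:E
     <= (N (poly_mx p Phi - Psi))%:E / delta)%E.
Proof.
move=> _ _ _ psi_mono WW VV PhiW PsiV r1 jrn _ _ _ _ J a1 b1 delta1 a2 b2 delta2
  delta AB Wj Vj N uiN.
have WW' : W *m W^T = 1%:M by exact: mulmx1C.
have VV' : V *m V^T = 1%:M by exact: mulmx1C.
pose K := W^T *m V; pose d := \row_i p.[phi i]; pose e := \row_i psi i.
have OW : orthogonal_mx W by []. have OV : orthogonal_mx V by [].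
have OK : orthogonal_mx K by apply: orthogonal_mx_mul => //; exact: orthogonal_mx_tr.
(* The matrix on the left is [W *m (set_proj R J *m K *m set_proj R (~: J)) *m V^T], with orthogonal
   outer factors. *)
have -> : N (Wj *m Wj^T *m (1%:M - Vj *m Vj^T)) =
    N (set_proj R J *m K *m set_proj R (~: J)).
  rewrite /Wj /Vj !colblock_proj // -/J set_projC.
  rewrite -(uinormM uiN (set_proj R J *m K *m _) OW (orthogonal_mx_tr OV)).
  congr N; rewrite [LHS]mulmxBr mulmx1 mulmxBr mulmx1 mulmxBr mulmxBl /K !mulmxA.
  by congr (_ - _); rewrite -(mulmxA _ V V^T) VV' mulmx1.
have HE : N (diag_mx d *m K - K *m diag_mx e) = N (poly_mx p Phi - Psi).
  rewrite -[RHS](uinormM uiN _ (orthogonal_mx_tr OW) OV).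
  congr N; rewrite mulmxBr mulmxBl -(mulmxA _ Psi) (mx_eigen PsiV) !mulmxA.
  congr (_ - _); rewrite -[poly_mx p Phi]mulmx1 -WW' !mulmxA.
  by rewrite -(mulmxA _ (poly_mx p Phi)) (poly_mx_eigen p PhiW) !mulmxA WW mul1mx.
clearbody K.
have jn : (j < n)%N by apply: leq_trans jrn; rewrite -addn1 leq_add2l.
have jrn' : ((j + r).-1 < n)%N by rewrite prednK // addn_gt0 r1 orbT.
(* As [r >= 1], [J] is nonempty, which makes the extrema of [p] over it finite. *)
have i0J : Ordinal jn \in J by rewrite inE leqnn -addn1 leq_add2l.
have [m mE] := minp_fin p phi i0J; have [M ME] := maxp_fin p phi i0J.
have mp i : i \in J -> m <= p.[phi i] by move=> /(minp_le p phi); rewrite mE lee_fin.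
have pM i : i \in J -> p.[phi i] <= M by move=> /(maxp_ge p phi); rewrite ME lee_fin.
have JC k : k \in ~: J -> (k < j)%N \/ (j + r <= k)%N.
  rewrite !inE negb_and -ltnNge -leqNgt => /orP[]; by [left | right].
case: AB => -[cover [delta_gt0 [_ [_ ->]]]]; apply: lee_div_bound => //;
  try exact: uinorm_ge0.
  (* Case (A): the values of [p] on [J] span the interval, and monotonicity keeps every [psi k] with
     [k] outside [J] beyond the nearer of the two neighbouring eigenvalues. *)
  move=> del del0; rewrite le_min => /andP[del1 del2]; rewrite -HE.
  rewrite /b1 ME in del1; rewrite /a1 mE in del2.
  apply: (davis_kahan uiN K (a := m) (b := M)) => //.
  - exact: le_trans (mp _ i0J) (pM _ i0J).
  - by move=> i iJ; rewrite mxE mp //= pM.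
  - move=> k /JC[kj|jrk]; rewrite mxE.
      by left; apply: lee_gap_sub del2 _; exact: ext_eig_ge.
    by right; apply: lee_sub_gap del1 _; exact: ext_eig_le.
(* Case (B): now the [psi i] with [i] in [J] span the interval and the values of [p] off [J] are
   separated from it, which controls the other off-diagonal block. *)
move=> del del0; rewrite le_min => /andP[del1 del2]; rewrite -HE.
rewrite set_projC uinorm_off_diagonal ?tr_set_proj ?set_proj_idem // -set_projC.
(* The 1-based positions [j + r] and [j.+1] are the 0-based indices [(j + r).-1] and [j]. *)
have b2E : b2 = (psi (Ordinal jrn'))%:E.
  by rewrite -ext_eig_fin prednK // addn_gt0 r1 orbT.
have a2E : a2 = (psi (Ordinal jn))%:E by rewrite -ext_eig_fin.
rewrite b2E in del1; rewrite a2E in del2.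
(* Transposition and a change of sign exchange the roles of [d] and [e] and replace [K] by [K^T],
   the form required by [davis_kahan]. *)
rewrite -(uinorm_trmx uiN (_ *m _ *m _)) !trmx_mul !tr_set_proj mulmxA.
rewrite -(uinormN uiN (diag_mx d *m K - _)) -(uinorm_trmx uiN (- _)).
have -> : (- (diag_mx d *m K - K *m diag_mx e))^T =
    diag_mx e *m K^T - K^T *m diag_mx d.
  by rewrite opprB [LHS]raddfB /= !trmx_mul !tr_diag_mx.
apply: (davis_kahan uiN K^T (a := psi (Ordinal jn)) (b := psi (Ordinal jrn'))) => //.
- by apply: psi_mono; rewrite -ltnS prednK ?addn_gt0 ?r1 ?orbT // -addn1 leq_add2l.
- move=> i; rewrite inE mxE => /andP[ji ijr]; rewrite !psi_mono //=.
  by rewrite -ltnS prednK // addn_gt0 r1 orbT.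
(* The covering assumption puts each index outside [J] in [Aset1], above the interval, or in
   [Aset2], below it. *)
- move=> k; rewrite -cover => /setUP[]kA; rewrite mxE.
    by right; apply: lee_sub_gap del1 _; rewrite -b2E; exact: minp_le.
  by left; apply: lee_gap_sub del2 _; rewrite -a2E; exact: maxp_ge.
Qed.
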